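(* Let $U$ be a compact connected semisimple Lie group and let $\mathbb{F}_\Theta=\mathrm{Ad}(U)(iH)$ be a flag with dual flag $\mathbb{F}_{\Theta^*}=\mathrm{Ad}(U)(i\sigma(H))$. For $m\in U$ let $\mathcal{L}_m\subset\mathbb{F}_\Theta\times\mathbb{F}_{\Theta^*}$ be the Lagrangian orbit of the subgroup $\Delta^m=\{(u,mum^{-1}):u\in U\}\subset U\times U$ given by the graph of the map $-\mathrm{Ad}(m):\mathrm{Ad}(U)(iH)\to\mathrm{Ad}(U)(i\sigma(H))$. Then all the Lagrangian orbits $\mathcal{L}_m$, $m\in U$, belong to the same Hamiltonian isotopy class in $\mathbb{F}_\Theta\times\mathbb{F}_{\Theta^*}$.
   Context: Let $\mathfrak{u}$ be the Lie algebra of $U$, $\langle\cdot,\cdot\rangle$ its Cartan--Killing form, $\mathfrak{t}=i\mathfrak{h}_{\mathbb{R}}$ the Lie algebra of a maximal torus; $H$ lies in the closure of the positive Weyl chamber of $\mathfrak{h}_{\mathbb{R}}$. The flags are realized as adjoint orbits of $U$ in $\mathfrak{u}$, each with the Kirillov--Kostant--Souriau symplectic form $\omega_x([X,x],[Y,x])=\langle x,[X,Y]\rangle$; the product has the product symplectic form (sum of pullbacks from the factors). $\sigma=-w_0$ with $w_0$ the longest element of the Weyl group, so that $\mathrm{Ad}(U)(i\sigma(H))=\mathrm{Ad}(U)(-iH)$. The group $U\times U$ acts by $(u_1,u_2)\cdot(x,y)=(\mathrm{Ad}(u_1)x,\mathrm{Ad}(u_2)y)$. Two Lagrangian submanifolds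 $\mathcal{L}_1,\mathcal{L}_2$ are Hamiltonian isotopic if there is a smooth isotopy $\varphi_t$, $t\in[0,1]$, of the ambient symplectic manifold with $\varphi_0=\mathrm{id}$, generated by Hamiltonian vector fields, with $\varphi_1(\mathcal{L}_1)=\mathcal{L}_2$. *)

(* Defs.v *)
From HB Require Import structures.
From mathcomp Require Import all_boot all_order all_algebra.
From mathcomp Require Import all_classical all_reals all_analysis.

Set Implicit Arguments.
Unset Strict Implicit.
Unset Printing Implicit Defensive.

Import Order.TTheory GRing.Theory Num.Theory.
Import numFieldNormedType.Exports.

Local Open Scope classical_set_scope.
Local Open Scope ring_scope.

(** * Smooth maps *)

(* [V] and [W] are only used with finite-dimensional spaces, where a map is
   C^(k+1) on the open set [D] iff it is differentiable on [D] and all its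
   directional derivatives are C^k on [D]. *)
Fixpoint Ck (R : realType) (V W : normedModType R) (k : nat) (D : set V)
    (f : V -> W) : Prop :=
  match k with
  | 0 => forall x, D x -> {for x, continuous f}
  | k'.+1 => (forall x, D x -> differentiable f x) /\
             (forall v, Ck k' D (fun x => 'D_v f x))
  end.

Definition smooth (R : realType) (V W : normedModType R) (D : set V)
    (f : V -> W) : Prop := forall k, Ck k D f.

(* [g] is a smooth extension of [f|A] to a neighbourhood of [z]; a map on a
   submanifold (possibly with boundary) [A] of a vector space is smooth iff it
   has such an extension around each point of [A]. *)
Definition smooth_extension (R : realType) (V W : normedModType R) (A : set V)
    (f : V -> W) (z : V) (g : V -> W) : Prop :=
  exists O : set V, [/\ open O, O z, smooth O g &
    forall y, A y -> O y -> g y = f y].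

Definition smooth_on (R : realType) (V W : normedModType R) (A : set V)
    (f : V -> W) : Prop :=
  forall z, A z -> exists g, smooth_extension A f z g.

(** * Lie groups *)

Record chart (R : realType) (n : nat) (T : topologicalType) := Chart {
  chart_dom : set T;
  chart_map :> T -> 'rV[R]_n;
  chart_inv : 'rV[R]_n -> T }.

Definition chart_im (R : realType) (n : nat) (T : topologicalType)
  (a : chart R n T) : set 'rV[R]_n := a @` chart_dom a.

Definition is_chart (R : realType) (n : nat) (T : topologicalType)
    (a : chart R n T) : Prop :=
  [/\ open (chart_dom a), open (chart_im a),
      forall x, chart_dom a x -> chart_inv a (a x) = x,
      forall x, chart_dom a x -> {for x, continuous a} &
      forall p, chart_im a p -> {for p, continuous (chart_inv a)}].

Definition smooth_atlas (R : realType) (n : nat) (T : topologicalType)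
    (A : set (chart R n T)) : Prop :=
  [/\ forall a, A a -> is_chart a,
      forall x, exists2 a, A a & chart_dom a x &
      forall a b, A a -> A b ->
        smooth [set p | chart_im a p /\ chart_dom b (chart_inv a p)]
               (fun p => b (chart_inv a p))].

HB.mixin Record isLieGroup (R : realType) (n : nat) U
    of Topological U & Group U := {
  lie_hausdorff : hausdorff_space U;
  lie_second_countable : @second_countable U;
  lie_atlas : set (chart R n U);
  lie_atlasP : smooth_atlas lie_atlas;
  lie_mul_continuous : continuous (fun p : U * U => (p.1 * p.2)%g);
  lie_inv_continuous : continuous (fun x : U => x^-1%g);
  lie_mul_smooth : forall a b c, lie_atlas a -> lie_atlas b -> lie_atlas c ->
    smooth [set p : 'rV[R]_n * 'rV[R]_n | [/\ chart_im a p.1, chart_im b p.2 &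
              chart_dom c (chart_inv a p.1 * chart_inv b p.2)%g]]
           (fun p => c (chart_inv a p.1 * chart_inv b p.2)%g);
  lie_inv_smooth : forall a b, lie_atlas a -> lie_atlas b ->
    smooth [set p : 'rV[R]_n | chart_im a p /\ chart_dom b (chart_inv a p)^-1%g]
           (fun p => b (chart_inv a p)^-1%g) }.

#[short(type="lieGroupType")]
HB.structure Definition LieGroup (R : realType) (n : nat) :=
  {U of isLieGroup R n U & Topological U & Group U}.

(** * The Lie algebra *)

(* The tangent space of [U] at the identity is read in a chart [c] around the
   identity, i.e. the Lie algebra is carried by ['rV[R]_n]. *)
Definition is_chart_at1 (R : realType) (n : nat) (U : lieGroupType R n)
    (c : chart R n U) : Prop :=
  lie_atlas c /\ chart_dom c 1%g.

Definition Ad (R : realType) (n : nat) (U : lieGroupType R n)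
    (c : chart R n U) (g : U) : 'rV[R]_n -> 'rV[R]_n :=
  'd (fun p : 'rV[R]_n => c (g * chart_inv c p * g^-1)%g) (c 1%g).

(* [X, Y] = ad(X) Y, where ad is the derivative of Ad at the identity. *)
Definition bracket (R : realType) (n : nat) (U : lieGroupType R n)
    (c : chart R n U) (X Y : 'rV[R]_n) : 'rV[R]_n :=
  'd (fun p : 'rV[R]_n => Ad c (chart_inv c p) Y) (c 1%g) X.

Definition killing (R : realType) (n : nat) (U : lieGroupType R n)
    (c : chart R n U) (X Y : 'rV[R]_n) : R :=
  \tr (lin1_mx (bracket c X) *m lin1_mx (bracket c Y)).

Definition is_ideal (R : realType) (n : nat) (U : lieGroupType R n)
    (c : chart R n U) (I : {vspace 'rV[R]_n}) : Prop :=
  forall X Y, Y \in I -> bracket c X Y \in I.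

Definition derived (R : realType) (n : nat) (U : lieGroupType R n)
    (c : chart R n U) (I : {vspace 'rV[R]_n}) : {vspace 'rV[R]_n} :=
  <<[seq bracket c X Y | X <- vbasis I, Y <- vbasis I]>>%VS.

Definition is_solvable (R : realType) (n : nat) (U : lieGroupType R n)
    (c : chart R n U) (I : {vspace 'rV[R]_n}) : Prop :=
  exists k, iter k (derived c) I = 0%VS.

Definition semisimple (R : realType) (n : nat) (U : lieGroupType R n)
    (c : chart R n U) : Prop :=
  forall I : {vspace 'rV[R]_n}, is_ideal c I -> is_solvable c I -> I = 0%VS.

(** * Maximal tori, roots and Weyl group *)

Definition is_torus (R : realType) (n : nat) (U : lieGroupType R n)
    (T : set U) : Prop :=
  [/\ T 1%g, forall x y, T x -> T y -> T (x * y^-1)%g,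
      forall x y, T x -> T y -> (x * y)%g = (y * x)%g,
      compact T & connected T].

Definition is_maximal_torus (R : realType) (n : nat) (U : lieGroupType R n)
    (T : set U) : Prop :=
  is_torus T /\ forall T', is_torus T' -> T `<=` T' -> T' = T.

(* velocities at 0 of the one-parameter subgroups of [U] lying in [T] *)
Definition lie_subalgebra (R : realType) (n : nat) (U : lieGroupType R n)
    (c : chart R n U) (T : set U) : set 'rV[R]_n :=
  [set X | exists gamma : R^o -> U,
    [/\ continuous gamma,
        forall s t, gamma (s + t) = (gamma s * gamma t)%g,
        forall t, T (gamma t) &
        is_derive (0 : R^o) (1 : R^o) (c \o gamma) X]].

(* Elements H of h_R are represented by x = iH in t = Lie(T), and a root alpha
   by the function x |-> alpha(H), set to 0 outside t.  The root vector is
   E = X + iY in the complexification, and the two equations are the real and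
   imaginary parts of [x, E] = i alpha(H) E. *)
Definition is_root (R : realType) (n : nat) (U : lieGroupType R n)
    (c : chart R n U) (T : set U) (alpha : 'rV[R]_n -> R) : Prop :=
  [/\ forall x, ~ lie_subalgebra c T x -> alpha x = 0,
      exists2 x, lie_subalgebra c T x & alpha x != 0 &
      exists X Y, (X, Y) != (0, 0) /\
        forall x, lie_subalgebra c T x ->
          bracket c x X = - (alpha x *: Y) /\ bracket c x Y = alpha x *: X].

Definition is_positive_system (R : realType) (n : nat) (U : lieGroupType R n)
    (c : chart R n U) (T : set U) (P : set ('rV[R]_n -> R)) : Prop :=
  [/\ P `<=` is_root c T,
      forall alpha, is_root c T alpha -> P alpha \/ P (- alpha),
      forall alpha, ~ (P alpha /\ P (- alpha)) &
      forall alpha beta, P alpha -> P beta -> is_root c T (alpha + beta) ->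
        P (alpha + beta)].

Definition positive_chamber (R : realType) (n : nat) (U : lieGroupType R n)
    (c : chart R n U) (T : set U) (P : set ('rV[R]_n -> R)) : set 'rV[R]_n :=
  [set x | lie_subalgebra c T x /\ forall alpha, P alpha -> 0 < alpha x].

(* Elements of the Weyl group N(T)/T are represented by elements [w] of N(T),
   acting on t by [Ad c w]. *)
Definition normalizer (R : realType) (n : nat) (U : lieGroupType R n)
    (T : set U) : set U :=
  [set w | [set (w * g * w^-1)%g | g in T] = T].

Definition inversions (R : realType) (n : nat) (U : lieGroupType R n)
    (c : chart R n U) (P : set ('rV[R]_n -> R)) (w : U) :
    set ('rV[R]_n -> R) :=
  [set alpha | P alpha /\ P (- (alpha \o Ad c w^-1%g))].

(* The length of a Weyl group element is its number of inversions. *)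
Definition is_longest (R : realType) (n : nat) (U : lieGroupType R n)
    (c : chart R n U) (T : set U) (P : set ('rV[R]_n -> R)) (w0 : U) : Prop :=
  normalizer T w0 /\
  forall w, normalizer T w -> (inversions c P w #<= inversions c P w0)%card.

(** * Adjoint orbits *)

Definition flag (R : realType) (n : nat) (U : lieGroupType R n)
    (c : chart R n U) (x : 'rV[R]_n) : set 'rV[R]_n :=
  [set Ad c u x | u in [set: U]].

(* omega_x([X, x], [Y, x]) = <x, [X, Y]>; the value does not depend on the
   choice of the lifts X and Y. *)
Definition kks (R : realType) (n : nat) (U : lieGroupType R n)
    (c : chart R n U) (x a b : 'rV[R]_n) : R :=
  let lift v := xget 0 [set X | bracket c X x = v] in
  killing c x (bracket c (lift a) (lift b)).

Definition kks_prod (R : realType) (n : nat) (U : lieGroupType R n)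
    (c : chart R n U) (z v w : 'rV[R]_n * 'rV[R]_n) : R :=
  kks c z.1 v.1 w.1 + kks c z.2 v.2 w.2.

Definition tangent_prod (R : realType) (n : nat) (U : lieGroupType R n)
    (c : chart R n U) (z : 'rV[R]_n * 'rV[R]_n) : set ('rV[R]_n * 'rV[R]_n) :=
  [set v | exists X Y, v = (bracket c X z.1, bracket c Y z.2)].

(* action of U x U on u x u *)
Definition act_prod (R : realType) (n : nat) (U : lieGroupType R n)
    (c : chart R n U) (u : U * U) (z : 'rV[R]_n * 'rV[R]_n) :
    'rV[R]_n * 'rV[R]_n :=
  (Ad c u.1 z.1, Ad c u.2 z.2).

Definition Delta (R : realType) (n : nat) (U : lieGroupType R n) (m : U) :
    set (U * U) :=
  [set (u, (m * u * m^-1)%g) | u in [set: U]].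

(* the orbit of Delta^m through (x, - Ad(m) x), i.e. the graph of - Ad(m) on
   Ad(U) x; see [lagrangian_orbit_graph] *)
Definition lagrangian_orbit (R : realType) (n : nat) (U : lieGroupType R n)
    (c : chart R n U) (x : 'rV[R]_n) (m : U) : set ('rV[R]_n * 'rV[R]_n) :=
  [set act_prod c u (x, - Ad c m x) | u in Delta m].

Lemma lie_mulr_continuous (R : realType) (n : nat) (U : lieGroupType R n)
  (g : U) : continuous (fun x : U => (x * g)%g).
Proof.
move=> x.
apply: (@cvg_comp _ _ _ (fun x : U => (x, g)) (fun p : U * U => (p.1 * p.2)%g)
  _ (nbhs (x, g))); last exact: (@lie_mul_continuous R n U (x, g)).
by apply: cvg_pair; [exact: cvg_id | exact: cvg_cst].
Qed.

Lemma lie_mull_continuous (R : realType) (n : nat) (U : lieGroupType R n)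
  (g : U) : continuous (fun x : U => (g * x)%g).
Proof.
move=> x.
apply: (@cvg_comp _ _ _ (fun x : U => (g, x)) (fun p : U * U => (p.1 * p.2)%g)
  _ (nbhs (g, x))); last exact: (@lie_mul_continuous R n U (g, x)).
by apply: cvg_pair; [exact: cvg_cst | exact: cvg_id].
Qed.

Lemma near_eq_diff (R : realType) (V W : normedModType R) (f g : V -> W)
    (x : V) : (\forall y \near x, f y = g y) -> differentiable g x ->
  differentiable f x /\ ('d f x = 'd g x :> (V -> W)).
Proof.
move=> fg dg; have fgx : f x = g x by exact: nbhs_singleton fg.
have E : f \o shift x = cst (f x) + 'd g x +o_ 0 id.
  have /eqaddoP gE := diff_locally dg; apply/eqaddoP => e /gE ge.
  have fg0 : \forall y \near (0 : V), f (y + x) = g (y + x).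
    by move: fg; rewrite (near_shift 0 x) subr0.
  near=> y.
  have fgy : f (y + x) = g (y + x) by near: y.
  have -> : (f \o shift x - (cst (f x) + 'd g x)) y =
     (g \o shift x - (cst (g x) + 'd g x)) y.
    by rewrite !fctE /= fgy fgx.
  by near: y.
have dfE : 'd f x = 'd g x :> (V -> W).
  by apply: diff_unique => //; exact: diff_continuous.
split=> //; apply/diff_locallyP; rewrite dfE; split=> //.
exact: diff_continuous.
Unshelve. all: by end_near. Qed.

Section Adjoint.
Context (R : realType) (n : nat) (U : lieGroupType R n).
Context (c : chart R n U) (c1 : is_chart_at1 c).

Lemma at1_chart : is_chart c.
Proof. by have [cA _] := c1; have [+ _ _] := @lie_atlasP R n U; exact. Qed.

Lemma chart_inv1 : chart_inv c (c 1%g) = 1%g.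
Proof. by have [_ _ + _ _] := at1_chart; apply; case: c1. Qed.

Lemma chart_im1 : chart_im c (c 1%g).
Proof. by exists 1%g => //; case: c1. Qed.

Lemma chart_inv_cvg1 : chart_inv c p @[p --> c 1%g] --> (1%g : U).
Proof.
have [_ _ _ _ ccont] := at1_chart.
have : chart_inv c p @[p --> c 1%g] --> chart_inv c (c 1%g).
  exact: ccont chart_im1.
by rewrite chart_inv1.
Qed.

Lemma mull_chart_cvg1 (g : U) :
  (g * chart_inv c p)%g @[p --> c 1%g] --> (g : U).
Proof.
have h : (g * x)%g @[x --> (1%g : U)] --> (g : U).
  by have := @lie_mull_continuous R n U g 1%g; rewrite /continuous_at mulg1.
exact: (cvg_comp (chart_inv c) (fun x : U => (g * x)%g) chart_inv_cvg1 h).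
Qed.

Lemma conj_chart_cvg1 (g : U) :
  (g * chart_inv c p * g^-1)%g @[p --> c 1%g] --> (1%g : U).
Proof.
have h : (x * g^-1)%g @[x --> (g : U)] --> (1%g : U).
  by have := @lie_mulr_continuous R n U g^-1%g g; rewrite /continuous_at mulgV.
exact: (cvg_comp (fun p => g * chart_inv c p)%g (fun x : U => (x * g^-1)%g)
  (@mull_chart_cvg1 g) h).
Qed.

Lemma conj_chart_diff (g : U) :
  differentiable (fun p : 'rV[R]_n => c (g * chart_inv c p * g^-1)%g) (c 1%g).
Proof.
have [cA cd] := c1.
have [Achart Acov _] := @lie_atlasP R n U.
have [b bA bg] := Acov g; have [d dA dg] := Acov (g^-1%g).
have [bo _ bK _ _] := Achart _ bA; have [_ _ dK _ _] := Achart _ dA.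
pose F p := b (chart_inv b (b g) * chart_inv c p)%g.
pose G q := c (chart_inv b q * chart_inv d (d g^-1))%g.
have Fc1 : F (c 1%g) = b g by rewrite /F chart_inv1 bK// mulg1.
have dF : differentiable F (c 1%g).
  apply: (@differentiable_comp _ _ _ _ (fun p => (b g, p))
    (fun q => b (chart_inv b q.1 * chart_inv c q.2)%g)).
    by apply: differentiable_pair => //.
  have [+ _] := lie_mul_smooth _ _ _ bA cA bA 1%N; apply => /=; split.
  - by exists g.
  - exact: chart_im1.
  - by rewrite chart_inv1 bK// mulg1.
have dG : differentiable G (b g).
  apply: (@differentiable_comp _ _ _ _ (fun p => (p, d g^-1%g))
    (fun q => c (chart_inv b q.1 * chart_inv d q.2)%g)).
    by apply: differentiable_pair => //.
  have [+ _] := lie_mul_smooth _ _ _ bA dA cA 1%N; apply => /=; split.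
  - by exists g.
  - by exists g^-1%g.
  - by rewrite (bK g)// (dK g^-1%g)// mulgV.
have dGF : differentiable (G \o F) (c 1%g).
  by apply: differentiable_comp => //; rewrite Fc1.
apply: (near_eq_diff _ dGF).1.
have bnbhs : nbhs g (chart_dom b) by apply: open_nbhs_nbhs; split.
near=> p.
have bp : chart_dom b (g * chart_inv c p)%g.
  by near: p; exact: (mull_chart_cvg1 bnbhs).
by rewrite /G /F /= (bK g)// (dK g^-1%g)// bK.
Unshelve. all: by end_near. Qed.

Lemma Ad_mul (g h : U) (x : 'rV[R]_n) : Ad c (g * h)%g x = Ad c g (Ad c h x).
Proof.
have [cA cd] := c1.
have [co _ cK _ _] := at1_chart.
have nc : nbhs (1%g : U) (chart_dom c) by apply: open_nbhs_nbhs; split.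
pose F k p := c (k * chart_inv c p * k^-1)%g.
have Fc1 k : F k (c 1%g) = c 1%g by rewrite /F chart_inv1 mulg1 mulgV.
have dgh : differentiable (F g \o F h) (c 1%g).
  by apply: differentiable_comp; rewrite ?Fc1; exact: conj_chart_diff.
have [_ E] : differentiable (F (g * h)%g) (c 1%g) /\
    ('d (F (g * h)%g) (c 1%g) = 'd (F g \o F h) (c 1%g) :> (_ -> _)).
  apply: (near_eq_diff _ dgh); near=> p.
  have hp : chart_dom c (h * chart_inv c p * h^-1)%g.
    by near: p; exact: (conj_chart_cvg1 h nc).
  by rewrite /F /= cK// invgM !mulgA.
have /(congr1 (@^~ x)) E' : 'd (F g \o F h) (c 1%g) =
    'd (F g) (F h (c 1%g)) \o 'd (F h) (c 1%g) :> (_ -> _).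
  by apply: diff_comp; rewrite ?Fc1; exact: conj_chart_diff.
rewrite Fc1 in E'.
exact: etrans (congr1 (@^~ x) E) E'.
Unshelve. all: by end_near. Qed.

Lemma AdN (g : U) (x : 'rV[R]_n) : Ad c g (- x) = - Ad c g x.
Proof. exact: raddfN. Qed.

Lemma lagrangian_orbit_graph (x : 'rV[R]_n) (m : U) :
  lagrangian_orbit c x m = [set (y, - Ad c m y) | y in flag c x].
Proof.
have E u : Ad c (m * u * m^-1)%g (- Ad c m x) = - Ad c m (Ad c u x).
  by rewrite AdN -(Ad_mul _ m) mulgVK Ad_mul.
apply/seteqP; split=> z.
  move=> [_ [u _ <-] <-]; exists (Ad c u x); first by exists u.
  by rewrite /act_prod /= E.
move=> [_ [u _ <-] <-]; exists (u, (m * u * m^-1)%g); first by exists u.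
by rewrite /act_prod /= E.
Qed.

End Adjoint.

(** * Hamiltonian isotopies *)

(* [M] is a submanifold of the vector space [V], with tangent spaces
   [tan z] and symplectic form [omega z]. *)

Definition diffeo (R : realType) (V : normedModType R) (M : set V)
    (f : V -> V) : Prop :=
  [/\ forall z, M z -> M (f z), smooth_on M f &
      exists g : V -> V, [/\ forall z, M z -> M (g z), smooth_on M g,
        forall z, M z -> g (f z) = z & forall z, M z -> f (g z) = z]].

(* [v] is the value at [z] of the Hamiltonian vector field of [h]:
   omega(v, -) = dh on the tangent space, dh being computed by means of a
   local smooth extension of [h]. *)
Definition hamiltonian_vector (R : realType) (V : normedModType R) (M : set V)
    (tan : V -> set V) (omega : V -> V -> V -> R) (h : V -> R^o) (z v : V) :
    Prop :=
  tan z v /\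
  exists2 g : V -> R^o, smooth_extension M h z g &
    forall w, tan z w -> omega z v w = 'd g z w.

(* The flow equation is only required for 0 < t < 1; it extends to t = 0, 1 by
   smoothness of [phi] and [h] on [0, 1] x M. *)
Definition hamiltonian_isotopic (R : realType) (V : normedModType R)
    (M : set V) (tan : V -> set V) (omega : V -> V -> V -> R)
    (L1 L2 : set V) : Prop :=
  exists (phi : R^o * V -> V) (h : R^o * V -> R^o),
    [/\ smooth_on ([set t : R^o | 0 <= t <= 1] `*` M) phi /\
        smooth_on ([set t : R^o | 0 <= t <= 1] `*` M) h,
        forall t : R^o, 0 <= t <= 1 -> diffeo M (fun z => phi (t, z)),
        forall z, M z -> phi (0, z) = z,
        forall (t : R^o) z, 0 < t < 1 -> M z ->
          exists2 v, is_derive t (1 : R^o) (fun s : R^o => phi (s, z)) v &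
            hamiltonian_vector M tan omega (fun y => h (t, y)) (phi (t, z)) v &
        [set phi (1, z) | z in L1] = L2].

(* Main.v *)
From HB Require Import structures.
Require Import Defs.
From mathcomp Require Import all_boot all_order all_algebra.
From mathcomp Require Import all_classical all_reals all_analysis.
Set Implicit Arguments.
Unset Strict Implicit.
Unset Printing Implicit Defensive.
Import Order.TTheory GRing.Theory Num.Theory.
Import numFieldNormedType.Exports.
Local Open Scope classical_set_scope.
Local Open Scope ring_scope.

(** The orbit L_m is the graph of - Ad(m), so Id x Ad(g) maps it to L_(g m)
    ([lagrangian_orbit_move]).  Choose a smooth path g(t) in U from 1 to
    m' m^-1 and let phi_t(x, y) = (x, Ad(g(t)) y); then phi_1 maps L_m to L_m'.
    It remains to see that phi_t is a Hamiltonian flow.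

    Let xi(t) = g'(t) g(t)^-1.  Then d/dt Ad(g(t)) y = [xi(t), Ad(g(t)) y], so
    that the velocity of phi_t at (x, y) is (0, [xi(t), y]).  This is the
    Hamiltonian vector field of h_t(x, y) = <xi(t), y>, because
    omega_y([xi, y], [Y, y]) = <y, [xi, Y]> = <xi, [Y, y]>
    ([kks_bracket], [hamiltonian_vector_Ad], [velocity_path_isotopy]).  These
    equalities are the invariance of the Killing form.  It comes from the
    Leibniz rule for the bracket ([leibniz]), which is the derivative of
    Ad(g) [X, Y] = [Ad(g) X, Ad(g) Y] ([Ad_bracket]).

    The path exists because U is connected.  Two paths that start at 1 can be
    multiplied pointwise, with velocity xi + Ad(g) eta ([reachable_mul]), and
    the points near 1 are reached by segments in a chart ([nbhs1_reachable]);
    so the set of end points of such paths is open and closed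
    ([reachable_connected]).

    Smoothness of Ad rests on a chain rule for maps of class C^k between
    finite-dimensional spaces ([Ck_comp]), applied to conjugation read in the
    chart ([chart_conj_smooth], [Ad_chart_smooth]). *)

(** * Calculus of C^k maps *)

Section Calculus.
Context {R : realType}.
Implicit Types V W Z : normedModType R.

Lemma Ck_subset V W k (D E : set V) (f : V -> W) :
  D `<=` E -> Ck k E f -> Ck k D f.
Proof.
elim: k f => [|k IH] f DE /=; first by move=> Ef x /DE; exact: Ef.
by move=> [dE hE]; split=> [x /DE|v]; [exact: dE | exact: IH].
Qed.

Lemma eq_Ck V W k (D : set V) (f g : V -> W) : f =1 g -> Ck k D f -> Ck k D g.
Proof. by move=> /funext ->. Qed.

Lemma open_near_eq V (T : Type) (D : set V) (f g : V -> T) x : open D ->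
  (forall y, D y -> f y = g y) -> D x -> \forall y \near x, f y = g y.
Proof.
move=> oD fg Dx; have : nbhs x D by exact: open_nbhs_nbhs.
by apply: filterS.
Qed.

(** The directional derivatives of two maps that agree on [D] agree on [D]
    again only because [D] is open. *)
Lemma Ck_eq V W k (D : set V) (f g : V -> W) : open D ->
  (forall x, D x -> f x = g x) -> Ck k D f -> Ck k D g.
Proof.
move=> oD; elim: k f g => [|k IH] f g fg /=.
  move=> Cf x Dx; have fgx := open_near_eq oD fg Dx.
  have : g @ x --> f x by apply: cvg_trans (Cf x Dx); exact: near_eq_cvg.
  by rewrite (fg _ Dx).
have gf x : D x -> g x = f x by move/fg.
move=> [df Df]; have dg x : D x ->
    differentiable g x /\ ('d g x = 'd f x :> (V -> W)).
  by move=> Dx; apply: near_eq_diff (df x Dx); exact: open_near_eq Dx.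
split=> [x /dg[]//|v]; apply: IH (Df v) => x Dx.
have [dgx E] := dg x Dx; have dfx := df x Dx.
apply: (etrans (deriveE v dfx)); apply: esym; apply: (etrans (deriveE v dgx)).
by rewrite E.
Qed.

Lemma CkW V W k (D : set V) (f : V -> W) : Ck k.+1 D f -> Ck k D f.
Proof.
elim: k f => [|k IH] f; last by move=> [df Df]; split=> // v; exact: IH (Df v).
by move=> [df _] x Dx; apply: differentiable_continuous; exact: df.
Qed.

Lemma derive_lin V W Z (L : {linear W -> Z}) (f : V -> W) x v :
  continuous L -> differentiable f x -> 'D_v (L \o f) x = L ('D_v f x).
Proof.
move=> cL df; have dL y : differentiable L y by exact: linear_differentiable.
rewrite !deriveE//; last exact: differentiable_comp.
by rewrite diff_comp// diff_lin.
Qed.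

Lemma Ck_lin V W Z k (D : set V) (L : {linear W -> Z}) (f : V -> W) :
  open D -> continuous L -> Ck k D f -> Ck k D (L \o f).
Proof.
move=> oD cL; elim: k f => [|k IH] f.
  by move=> Cf x Dx; apply: continuous_comp; [exact: Cf | exact: cL].
move=> [df Df]; split=> [x Dx|v].
  by apply: differentiable_comp (df x Dx) _; exact: linear_differentiable.
apply: Ck_eq (IH _ (Df v)) => // x Dx /=.
by rewrite derive_lin//; exact: df.
Qed.

Lemma Ck_cst V W k (D : set V) (w : W) : Ck k D (fun=> w).
Proof.
elim: k w => [|k IH] w; first by move=> x _; exact: cst_continuous.
split=> [x _|v]; first exact: differentiable_cst.
by apply: eq_Ck (IH 0) => x; rewrite derive_cst.
Qed.

Lemma Ck_id V k (D : set V) : Ck k D (fun x : V => x).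
Proof.
case: k => [|k]; first by move=> x _; exact: cvg_id.
split=> [x _|v]; first exact: ex_diff.
by apply: eq_Ck (Ck_cst k D v) => x; rewrite derive_id.
Qed.

Lemma derive_pair V W Z (f : V -> W) (g : V -> Z) x v :
  differentiable f x -> differentiable g x ->
  'D_v (fun y => (f y, g y)) x = ('D_v f x, 'D_v g x).
Proof.
move=> df dg; rewrite !deriveE//; last exact: differentiable_pair.
by rewrite diff_pair.
Qed.

Lemma Ck_pair V W Z k (D : set V) (f : V -> W) (g : V -> Z) :
  open D -> Ck k D f -> Ck k D g -> Ck k D (fun x => (f x, g x)).
Proof.
move=> oD; elim: k f g => [|k IH] f g.
  by move=> Cf Cg x Dx; apply: cvg_pair; [exact: Cf | exact: Cg].
move=> [df Df] [dg Dg]; split=> [x Dx|v].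
  by apply: differentiable_pair; [exact: df | exact: dg].
apply: Ck_eq (IH _ _ (Df v) (Dg v)) => // x Dx.
by rewrite derive_pair//; [exact: df | exact: dg].
Qed.

Lemma CkD V W k (D : set V) (f g : V -> W) :
  open D -> Ck k D f -> Ck k D g -> Ck k D (fun x => f x + g x).
Proof.
move=> oD; elim: k f g => [|k IH] f g.
  by move=> Cf Cg x Dx; apply: cvgD; [exact: Cf | exact: Cg].
move=> [df Df] [dg Dg]; split=> [x Dx|v].
  by apply: differentiableD; [exact: df | exact: dg].
apply: Ck_eq (IH _ _ (Df v) (Dg v)) => // x Dx.
by rewrite deriveD//; apply: diff_derivable; [exact: df | exact: dg].
Qed.

Lemma Ck_sum V W k (D : set V) (I : Type) (s : seq I) (F : I -> V -> W) :
  open D -> (forall i, Ck k D (F i)) -> Ck k D (fun x => \sum_(i <- s) F i x).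
Proof.
move=> oD FC; elim: s => [|i s IH].
  by apply: eq_Ck (Ck_cst k D 0) => x; rewrite big_nil.
by apply: eq_Ck (CkD oD (FC i) IH) => x; rewrite big_cons.
Qed.

(** Scalar multiplication is a continuous bilinear map, so the product rule
    is the formula for the differential of such a map. *)
Lemma diff_scale V W (a : V -> R^o) (f : V -> W) x :
  differentiable a x -> differentiable f x ->
  differentiable (fun y => a y *: f y) x /\
  ('d (fun y => a y *: f y) x = (fun v => a x *: 'd f x v + 'd a x v *: f x)
   :> (V -> W)).
Proof.
move=> da df.
have blin : bilinear_for *:%R *:%R (fun (r : R^o) (w : W) => r *: w).
  split=> [w|r] b u v /=; first by rewrite scalerDl scalerA.
  by rewrite scalerDr !scalerA mulrC.
pose m := bilinear_isBilinear.Build _ _ _ _ _ _ _ blin.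
pose B : {bilinear R^o -> W -> W} :=
  HB.pack (fun (r : R^o) (w : W) => r *: w) m.
have cB : continuous (fun p : R^o * W => B p.1 p.2).
  by move=> p; apply: cvgZ; [exact: cvg_fst | exact: cvg_snd].
have dp : differentiable (fun y => (a y, f y)) x by exact: differentiable_pair.
have dB := differentiable_bilin (a x, f x) cB.
split; first exact: (differentiable_comp dp dB).
by have := diff_comp dp dB; rewrite diff_bilin// diff_pair.
Qed.

Lemma Ck_scale V W k (D : set V) (a : V -> R^o) (f : V -> W) :
  open D -> Ck k D a -> Ck k D f -> Ck k D (fun x => a x *: f x).
Proof.
move=> oD; elim: k a f => [|k IH] a f.
  by move=> Ca Cf x Dx; apply: cvgZ; [exact: Ca | exact: Cf].
move=> Ca Cf; have [da Da] := Ca; have [df Df] := Cf; split=> [x Dx|v].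
  by apply: (diff_scale _ _).1; [exact: da | exact: df].
have H : Ck k D (fun x => a x *: 'D_v f x + 'D_v a x *: f x).
  apply: CkD => //; apply: IH.
  - exact: CkW Ca.
  - exact: Df.
  - exact: Da.
  - exact: CkW Cf.
apply: Ck_eq H => // x Dx.
have [dx E] := diff_scale (da x Dx) (df x Dx).
apply: esym; apply: (etrans (deriveE v dx)).
apply: (etrans (congr1 (@^~ v) E)).
by rewrite (deriveE v (df x Dx)) (deriveE v (da x Dx)).
Qed.

Definition rV_coord n (i : 'I_n) (v : 'rV[R]_n) : R^o := v ord0 i.

Fact rV_coord_linear n (i : 'I_n) : linear (rV_coord i).
Proof. by move=> a u v; rewrite /rV_coord !mxE. Qed.

HB.instance Definition _ n (i : 'I_n) :=
  GRing.isLinear.Build R 'rV[R]_n R^o _ (rV_coord i) (rV_coord_linear i).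

Lemma rV_coord_continuous n (i : 'I_n) : continuous (rV_coord i).
Proof. exact: (@coord_continuous R 1 n ord0 i). Qed.

(** A frame with continuous coordinate forms is the part of finite
    dimensionality that the chain rule for [Ck] needs. *)
Definition has_frame W := exists (I : finType) (e : I -> W)
  (l : I -> {linear W -> R^o}),
  (forall i, continuous (l i)) /\ forall w, w = \sum_i l i w *: e i.

(** Induction on [k]: each directional derivative of a composite is a sum of
    products to which the induction hypothesis applies. *)
Lemma Ck_comp V W Z k (D : set V) (E : set W) (f : V -> W) (g : W -> Z) :
  has_frame W -> open D -> open E -> (forall x, D x -> E (f x)) ->
  Ck k D f -> Ck k E g -> Ck k D (g \o f).
Proof.
move=> [d [e [l [cl le]]]] oD oE fDE; elim: k g => [|k IH] g Cf Cg.
  by move=> x Dx; apply: continuous_comp; [exact: Cf | apply: Cg; exact: fDE].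
have [df Df] := Cf; have [dg Dg] := Cg; split=> [x Dx|v].
  by apply: differentiable_comp; [exact: df | apply: dg; exact: fDE].
(* D_v (g o f) = sum_i l_i (D_v f) (D_(e_i) g o f), where the frame has turned
   the varying direction D_v f into fixed ones. *)
have H : Ck k D (fun x => \sum_i (l i \o (fun x => 'D_v f x)) x *:
                                   ((fun y => 'D_(e i) g y) \o f) x).
  apply: Ck_sum => // i; apply: Ck_scale => //.
    exact: (Ck_lin oD (cl i) (Df v)).
  by apply: IH; [exact: CkW Cf | exact: Dg].
apply: Ck_eq H => // x Dx.
have dfx := df x Dx; have dgx := dg _ (fDE _ Dx).
rewrite [RHS]deriveE; last exact: differentiable_comp.
transitivity ('d g (f x) ('d f x v)); last first.
  by have /(congr1 (@^~ v)) := diff_comp dfx dgx.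
rewrite [in RHS](le ('d f x v)) linear_sum.
by apply: eq_bigr => i _; rewrite linearZ/= !deriveE.
Qed.

Lemma has_frame_rV n : has_frame 'rV[R]_n.
Proof.
exists 'I_n, (fun i => delta_mx 0 i), (fun i => rV_coord i : {linear _ -> _}).
split; first exact: rV_coord_continuous.
by move=> w; exact: row_sum_delta.
Qed.

Lemma has_frame_R : has_frame R^o.
Proof.
exists unit, (fun=> 1), (fun=> idfun); split.
  by move=> i x; exact: cvg_id.
move=> w; rewrite (big_pred1 tt) => [|[]//].
by rewrite /= /GRing.scale /= mulr1.
Qed.

Lemma has_frame_prod V W : has_frame V -> has_frame W -> has_frame (V * W)%type.
Proof.
move=> [I [e1 [l1 [c1 E1]]]] [J [e2 [l2 [c2 E2]]]].
pose e (i : I + J) : V * W :=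
  match i with inl j => (e1 j, 0) | inr j => (0, e2 j) end.
pose l (i : I + J) : {linear (V * W)%type -> R^o} :=
  match i with inl j => l1 j \o fst | inr j => l2 j \o snd end.
exists (I + J)%type, e, l; split.
  move=> [j|j] x /=.
    by apply: continuous_comp; [exact: cvg_fst | exact: c1].
  by apply: continuous_comp; [exact: cvg_snd | exact: c2].
move=> [v w]; rewrite big_sumType /=.
have Ea : \sum_i l1 i v *: (e1 i, 0 : W) = (v, 0).
  rewrite [in RHS](E1 v); elim/big_rec2: _ => // i a b _ ->.
  by congr pair; rewrite /= scaler0 add0r.
have Eb : \sum_i l2 i w *: (0 : V, e2 i) = (0, w).
  rewrite [in RHS](E2 w); elim/big_rec2: _ => // i a b _ ->.
  by congr pair; rewrite /= scaler0 add0r.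
by rewrite Ea Eb; congr pair; rewrite /= ?addr0 ?add0r.
Qed.

End Calculus.

(** * Smoothness at a point and differentials *)

Section SmoothAt.
Context {R : realType}.
Implicit Types V W Z : normedModType R.

(** Smoothness near a point; unlike [smooth D f] it composes without keeping
    track of domains. *)
Definition smooth_at V W (f : V -> W) (x : V) :=
  exists2 D, open_nbhs x D & smooth D f.

Lemma nbhs_smooth_at V W (D : set V) (f : V -> W) x :
  nbhs x D -> smooth D f -> smooth_at f x.
Proof.
rewrite nbhsE => - [B Bx BD] Df; exists B; first by [].
move=> k.
exact: Ck_subset BD (Df k).
Qed.

Lemma smooth_at_near V W (f : V -> W) x :
  smooth_at f x -> \forall y \near x, smooth_at f y.
Proof.
move=> [D [oD Dx] Df]; have : nbhs x D by exact: open_nbhs_nbhs.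
by apply: filterS => y Dy; exists D.
Qed.

Lemma smooth_at_differentiable V W (f : V -> W) x :
  smooth_at f x -> differentiable f x.
Proof. by move=> [D [_ Dx] Df]; exact: (Df 1%N).1. Qed.

Lemma smooth_at_continuous V W (f : V -> W) x :
  smooth_at f x -> {for x, continuous f}.
Proof. by move=> [D [_ Dx] Df]; exact: (Df 0%N). Qed.

Lemma near_eq_smooth_at V W (f g : V -> W) x :
  (\forall y \near x, f y = g y) -> smooth_at f x -> smooth_at g x.
Proof.
rewrite /prop_near1 nbhsE => - [E [oE Ex] Efg] [D [oD Dx] Df].
exists (D `&` E); first by split=> //; exact: openI.
move=> k; apply: (@Ck_eq _ _ _ _ _ f); first exact: openI.
  by move=> y [_ /Efg].
by apply: Ck_subset (Df k) => y [].
Qed.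

Lemma smooth_at_cst V W (w : W) (x : V) : smooth_at (fun=> w) x.
Proof.
by exists setT; [split=> //; exact: openT | move=> k; exact: Ck_cst].
Qed.

Lemma smooth_at_id V (x : V) : smooth_at (fun y : V => y) x.
Proof. by exists setT; [split=> //; exact: openT | move=> k; exact: Ck_id]. Qed.

Lemma smooth_at_lin V W Z (L : {linear W -> Z}) (f : V -> W) x :
  continuous L -> smooth_at f x -> smooth_at (fun y => L (f y)) x.
Proof.
by move=> cL [D [oD Dx] Df]; exists D => // k; exact: Ck_lin.
Qed.

Lemma smooth_at_binary V W1 W2 Z
    (F : (V -> W1) -> (V -> W2) -> V -> Z) (f : V -> W1) (g : V -> W2) x :
  (forall k (D : set V) f g,
     open D -> Ck k D f -> Ck k D g -> Ck k D (F f g)) ->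
  smooth_at f x -> smooth_at g x -> smooth_at (F f g) x.
Proof.
move=> FC [D [oD Dx] Df] [E [oE Ex] Eg]; exists (D `&` E).
  by split=> //; exact: openI.
move=> k; apply: FC; first exact: openI.
  by apply: Ck_subset (Df k) => y [].
by apply: Ck_subset (Eg k) => y [].
Qed.

Lemma smooth_at_pair V W Z (f : V -> W) (g : V -> Z) x :
  smooth_at f x -> smooth_at g x -> smooth_at (fun y => (f y, g y)) x.
Proof.
apply: (smooth_at_binary (F := fun f g y => (f y, g y))) => *.
exact: Ck_pair.
Qed.

Lemma smooth_atD V W (f g : V -> W) x :
  smooth_at f x -> smooth_at g x -> smooth_at (fun y => f y + g y) x.
Proof.
by apply: (smooth_at_binary (F := fun f g y => f y + g y)) => *; exact: CkD.
Qed.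

Lemma smooth_at_scale V W (a : V -> R^o) (f : V -> W) x :
  smooth_at a x -> smooth_at f x -> smooth_at (fun y => a y *: f y) x.
Proof.
apply: (smooth_at_binary (F := fun a f y => (a y : R^o) *: f y)) => *.
exact: Ck_scale.
Qed.

Lemma smooth_at_sum V W (I : Type) (s : seq I) (F : I -> V -> W) x :
  (forall i, smooth_at (F i) x) -> smooth_at (fun y => \sum_(i <- s) F i y) x.
Proof.
move=> FC; elim: s => [|i s IH].
  rewrite (_ : (fun y => _) = fun=> 0); first exact: smooth_at_cst.
  by apply/funext => y; rewrite big_nil.
rewrite (_ : (fun y => _) = fun y => F i y + \sum_(i <- s) F i y).
  exact: smooth_atD.
by apply/funext => y; rewrite big_cons.
Qed.

Lemma smooth_at_derive V W (f : V -> W) x v :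
  smooth_at f x -> smooth_at (fun y => 'D_v f y) x.
Proof. by move=> [D [oD Dx] Df]; exists D => // k; exact: (Df k.+1).2. Qed.

Lemma smooth_at_comp V W Z (f : V -> W) (g : W -> Z) x :
  has_frame W -> smooth_at f x -> smooth_at g (f x) ->
  smooth_at (fun y => g (f y)) x.
Proof.
move=> fW fx [E [oE Efx] Eg]; have cf := smooth_at_continuous fx.
have [D [oD Dx] Df] := fx.
have : nbhs x (D `&` f @^-1` E).
  apply: filterI; first exact: open_nbhs_nbhs.
  by apply: cf; exact: open_nbhs_nbhs.
rewrite nbhsE => - [B Bx BDE]; have [oB _] := Bx; exists B => // k.
apply: (Ck_comp fW oB oE) (Eg k); first by move=> y /BDE[].
by apply: Ck_subset (Df k) => y /BDE[].
Qed.

Lemma smooth_at_fst V W (x : V * W) : smooth_at (fun y : V * W => y.1) x.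
Proof.
apply: (smooth_at_lin (L := fst)) (smooth_at_id x) => y; exact: cvg_fst.
Qed.

Lemma smooth_at_snd V W (x : V * W) : smooth_at (fun y : V * W => y.2) x.
Proof.
apply: (smooth_at_lin (L := snd)) (smooth_at_id x) => y; exact: cvg_snd.
Qed.

Lemma smooth_at_on V W (A : set V) (f : V -> W) :
  (forall z, A z -> smooth_at f z) -> smooth_on A f.
Proof.
by move=> fA z /fA[D [oD Dz] Df]; exists f, D; split.
Qed.

Lemma near_smooth_at_pairl V W Z (f : V * W -> Z) x y :
  smooth_at f (x, y) -> \forall p \near x, smooth_at f (p, y).
Proof.
move=> /smooth_at_near H.
have h : (q, y) @[q --> x] --> (x, y).
  by apply: cvg_pair; [exact: cvg_id | exact: cvg_cst].
exact: h _ H.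
Qed.

Lemma linear_rV n W (L : 'rV[R]_n -> W) v : linear L ->
  L v = \sum_i v ord0 i *: L (delta_mx 0 i).
Proof.
move=> linL; pose L' : {linear 'rV[R]_n -> W} :=
  HB.pack L (GRing.isLinear.Build _ _ _ _ _ linL).
have -> : L v = L' (\sum_i v ord0 i *: delta_mx 0 i) by rewrite -row_sum_delta.
rewrite linear_sum.
by apply: eq_bigr => i _; rewrite linearZ.
Qed.

Lemma smooth_at_coord V n (b : V -> 'rV[R]_n) x i :
  smooth_at b x -> smooth_at (fun y => rV_coord i (b y)) x.
Proof. apply: smooth_at_lin; exact: rV_coord_continuous. Qed.

(** Expanding the argument [b y] in the standard basis reduces a varying linear
    map applied to a varying vector to products; [A y] is arbitrary, so that
    this covers [Ad (g t) y] and the Killing form alike. *)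
Lemma smooth_at_apply V W n (A : V -> 'rV[R]_n -> W) (b : V -> 'rV[R]_n) x :
  (forall y, linear (A y)) -> (forall v, smooth_at (A ^~ v) x) ->
  smooth_at b x -> smooth_at (fun y => A y (b y)) x.
Proof.
move=> linA sA sb.
rewrite (_ : (fun y => _) =
    fun y => \sum_i b y ord0 i *: A y (delta_mx 0 i)); last first.
  by apply/funext => y; exact: linear_rV.
apply: smooth_at_sum => i; apply: smooth_at_scale; last exact: sA.
exact: smooth_at_coord.
Qed.

Lemma smooth_at_linear_rV n W (L : 'rV[R]_n -> W) x : linear L -> smooth_at L x.
Proof.
move=> linL.
apply: (smooth_at_apply (A := fun=> L)) (smooth_at_id x) => // v.
exact: smooth_at_cst.
Qed.

Lemma linear_rV_continuous n W (L : {linear 'rV[R]_n -> W}) : continuous L.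
Proof.
move=> x; apply: smooth_at_continuous; apply: smooth_at_linear_rV.
exact: linearP.
Qed.

(** The product rule for the same situation as in [smooth_at_apply]. *)
Lemma diff_apply V W n (A : V -> 'rV[R]_n -> W) (b : V -> 'rV[R]_n) x v :
  (forall y, linear (A y)) -> (forall w, differentiable (A ^~ w) x) ->
  differentiable b x ->
  differentiable (fun y => A y (b y)) x /\
  'd (fun y => A y (b y)) x v = 'd (A ^~ (b x)) x v + A x ('d b x v).
Proof.
move=> linA dA db.
pose bi i y := rV_coord i (b y).
have dbi i : differentiable (bi i) x /\ 'd (bi i) x v = ('d b x v) ord0 i.
  have dl : differentiable (rV_coord i) (b x).
    by apply: linear_differentiable; exact: rV_coord_continuous.
  split; first exact: (differentiable_comp db dl).
  have /(congr1 (@^~ v)) := diff_comp db dl.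
  by rewrite diff_lin//; exact: rV_coord_continuous.
have AE : (fun y => A y (b y)) =
    \sum_i (fun y => bi i y *: A y (delta_mx 0 i)).
  by apply/funext => y; rewrite fct_sumE; exact: linear_rV.
have AbE : A ^~ (b x) = \sum_i (bi i x *: A ^~ (delta_mx 0 i)).
  by apply/funext => y; rewrite fct_sumE; exact: linear_rV.
have dis i := diff_scale (dbi i).1 (dA (delta_mx 0 i)).
have dsum : differentiable (fun y => A y (b y)) x.
  by rewrite AE; apply: differentiable_sum => i; exact: (dis i).1.
split=> //; rewrite -!deriveE//.
rewrite AE AbE !derive_sum; first last.
- by move=> i; apply: diff_derivable; exact: (dis i).1.
- by move=> i; apply: diff_derivable; apply: differentiableZ; exact: dA.
rewrite (linear_rV ('D_v b x) (linA x)) -big_split /=.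
apply: eq_bigr => i _; rewrite deriveZ; last exact: diff_derivable.
have [d1 e1] := dis i; have [d2 e2] := dbi i.
by rewrite !deriveE// e1 e2.
Qed.

Lemma diff_compE V W Z (f : V -> W) (g : W -> Z) x v :
  differentiable f x -> differentiable g (f x) ->
  'd (fun y => g (f y)) x v = 'd g (f x) ('d f x v).
Proof. by move=> df dg; have /(congr1 (@^~ v)) := diff_comp df dg. Qed.

Lemma diff_partiall (V1 V2 W : normedModType R) (F : V1 * V2 -> W) x y v :
  differentiable F (x, y) ->
  differentiable (fun q => F (q, y)) x /\
  'd (fun q => F (q, y)) x v = 'd F (x, y) (v, 0).
Proof.
move=> dF.
have H : is_diff x (fun q : V1 => (q, y)) (fun q => (q, 0 : V2)).
  by apply: is_diff_pair.
split; first exact: (differentiable_comp (f := fun q => (q, y))).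
by rewrite (diff_compE (f := fun q => (q, y)))// diff_val.
Qed.

Lemma diff_partialr (V1 V2 W : normedModType R) (F : V1 * V2 -> W) x y v :
  differentiable F (x, y) ->
  differentiable (fun q => F (x, q)) y /\
  'd (fun q => F (x, q)) y v = 'd F (x, y) (0, v).
Proof.
move=> dF.
have H : is_diff y (fun q : V2 => (x, q)) (fun q => (0 : V1, q)).
  by apply: is_diff_pair.
split; first exact: (differentiable_comp (f := fun q => (x, q))).
by rewrite (diff_compE (f := fun q => (x, q)))// diff_val.
Qed.

Lemma diff_line (V : normedModType R) (x w : V) (t v : R^o) :
  'd (fun s : R^o => x + s *: w) t v = v *: w.
Proof.
have H : is_diff (t : R^o) (fun s : R^o => x + s *: w) (fun s => s *: w).
  have := is_diffD (is_diff_cst x (t : R^o)) (is_diff_scalel t w).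
  by rewrite add0r.
by rewrite diff_val.
Qed.

Lemma diff_sndE V W (x v : V * W) : 'd (fun y : V * W => y.2) x v = v.2.
Proof.
have cs : continuous (snd : V * W -> W) by move=> y; exact: cvg_snd.
by have /(congr1 (@^~ v)) := diff_lin (f := snd) x cs.
Qed.

Lemma diff_is_derive W (f : R^o -> W) (t v : R^o) df :
  differentiable f t -> 'd f t v = df -> is_derive t v f df.
Proof.
by move=> dft <-; split; [exact: diff_derivable | exact: deriveE].
Qed.

Lemma is_derive_diff W (f : R^o -> W) (t v : R^o) df :
  differentiable f t -> is_derive t v f df -> 'd f t v = df.
Proof. by move=> dft [_ <-]; rewrite deriveE. Qed.

Lemma segment_ball W (p w : W) (r t : R) : `|w| < r -> 0 <= t <= 1 ->
  ball p r (p + t *: w).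
Proof.
move=> wr /andP[t0 t1].
rewrite -ball_normE /ball_ /= opprD addNKr normrN normrZ.
rewrite ger0_norm//; apply: le_lt_trans wr.
by rewrite ler_piMl.
Qed.

Lemma differentiable_linear_rV n W (L : 'rV[R]_n -> W) x :
  linear L -> differentiable L x.
Proof. by move=> linL; exact/smooth_at_differentiable/smooth_at_linear_rV. Qed.

Lemma diff_linear_rV n W (L : 'rV[R]_n -> W) x v : linear L -> 'd L x v = L v.
Proof.
move=> linL; pose L' : {linear 'rV[R]_n -> W} :=
  HB.pack L (GRing.isLinear.Build _ _ _ _ _ linL).
by have /(congr1 (@^~ v)) := diff_lin x (@linear_rV_continuous n W L').
Qed.

End SmoothAt.

(** * The adjoint representation in a chart *)

Section LieGroup.
Context {R : realType} {n : nat} {U : lieGroupType R n}.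
Context (c : chart R n U) (c1 : is_chart_at1 c).
Local Notation e := (c 1%g).

Lemma cvg_mul (S : topologicalType) (f g : S -> U) (x : S) (a b : U) :
  f y @[y --> x] --> a -> g y @[y --> x] --> b ->
  (f y * g y)%g @[y --> x] --> (a * b)%g.
Proof.
move=> fa gb.
apply: (@cvg_comp _ _ _ (fun y => (f y, g y)) (fun p : U * U => (p.1 * p.2)%g)
  _ (nbhs (a, b))); first exact: cvg_pair.
exact: (@lie_mul_continuous R n U (a, b)).
Qed.

Lemma cvg_inv (S : topologicalType) (f : S -> U) (x : S) (a : U) :
  f y @[y --> x] --> a -> ((f y)^-1)%g @[y --> x] --> (a^-1)%g.
Proof.
move=> fa; apply: (cvg_comp _ _ fa); exact: (@lie_inv_continuous R n U a).
Qed.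

Lemma chart_dom_nbhs1 : nbhs (1%g : U) (chart_dom c).
Proof.
have [co _ _ _ _] := at1_chart c1.
by apply: open_nbhs_nbhs; split=> //; case: c1.
Qed.

Lemma chart_im_nbhs1 : nbhs e (chart_im c).
Proof.
have [_ co _ _ _] := at1_chart c1.
by apply: open_nbhs_nbhs; split=> //; exact: chart_im1.
Qed.

Lemma chartK x : chart_dom c x -> chart_inv c (c x) = x.
Proof. by have [_ _ cK _ _] := at1_chart c1; exact: cK. Qed.

Lemma chart_inv_cvg p : chart_im c p ->
  chart_inv c q @[q --> p] --> (chart_inv c p : U).
Proof. by have [_ _ _ _ ci] := at1_chart c1; exact: ci. Qed.

Lemma near_chartK (S : topologicalType) (f : S -> U) (x : S) :
  f y @[y --> x] --> (1%g : U) ->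
  \forall y \near x, chart_inv c (c (f y)) = f y.
Proof.
move=> f1; near=> y; apply: chartK; near: y.
exact: f1 chart_dom_nbhs1.
Unshelve. all: by end_near. Qed.

Lemma fst_chart_inv_cvg1 :
  chart_inv c p.1 @[p --> (e, e)] --> (1%g : U).
Proof.
apply: (@cvg_comp _ _ _ (fun p : 'rV[R]_n * 'rV[R]_n => p.1) (chart_inv c)
  _ (nbhs e)).
  exact: cvg_fst.
exact: chart_inv_cvg1.
Qed.

Lemma snd_chart_inv_cvg1 :
  chart_inv c p.2 @[p --> (e, e)] --> (1%g : U).
Proof.
apply: (@cvg_comp _ _ _ (fun p : 'rV[R]_n * 'rV[R]_n => p.2) (chart_inv c)
  _ (nbhs e)).
  exact: cvg_snd.
exact: chart_inv_cvg1.
Qed.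

Definition chart_mul (p : 'rV[R]_n * 'rV[R]_n) : 'rV[R]_n :=
  c (chart_inv c p.1 * chart_inv c p.2)%g.

Definition chart_div (p : 'rV[R]_n * 'rV[R]_n) : 'rV[R]_n :=
  c (chart_inv c p.1 * (chart_inv c p.2)^-1)%g.

Definition chart_conj (p : 'rV[R]_n * 'rV[R]_n) : 'rV[R]_n :=
  c (chart_inv c p.1 * chart_inv c p.2 * (chart_inv c p.1)^-1)%g.

Lemma chart_mul_smooth : smooth_at chart_mul (e, e).
Proof.
have [cA cd] := c1; have sm := lie_mul_smooth _ _ _ cA cA cA.
apply: nbhs_smooth_at sm.
near=> p; split.
- near: p; exists (chart_im c, setT) => /=.
    by split; [exact: chart_im_nbhs1 | exact: filterT].
  by move=> q [].
- near: p; exists (setT, chart_im c) => /=.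
    by split; [exact: filterT | exact: chart_im_nbhs1].
  by move=> q [].
- near: p; have := cvg_mul fst_chart_inv_cvg1 snd_chart_inv_cvg1.
  by rewrite mulg1; apply; exact: chart_dom_nbhs1.
Unshelve. all: by end_near. Qed.

Lemma chart_invg_smooth :
  smooth_at (fun p : 'rV[R]_n => c (chart_inv c p)^-1%g) e.
Proof.
have [cA cd] := c1; have sm := lie_inv_smooth _ _ cA cA.
apply: nbhs_smooth_at sm.
near=> p; split; near: p; first exact: chart_im_nbhs1.
have := cvg_inv (chart_inv_cvg1 c1).
by rewrite invg1; apply; exact: chart_dom_nbhs1.
Unshelve. all: by end_near. Qed.

Local Notation frame_rV2 := (has_frame_prod (has_frame_rV n) (has_frame_rV n)).

Lemma chart_div_smooth : smooth_at chart_div (e, e).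
Proof.
pose f (p : 'rV[R]_n * 'rV[R]_n) := (p.1, c (chart_inv c p.2)^-1%g).
have sf : smooth_at f (e, e).
  apply: smooth_at_pair; first exact: smooth_at_fst.
  apply: (smooth_at_comp (f := fun p : 'rV[R]_n * 'rV[R]_n => p.2)
    (g := fun p => c (chart_inv c p)^-1%g)).
  - exact: has_frame_rV.
  - exact: smooth_at_snd.
  - exact: chart_invg_smooth.
have fe : f (e, e) = (e, e) by rewrite /f /= chart_inv1// invg1.
apply: near_eq_smooth_at (smooth_at_comp frame_rV2 sf (g := chart_mul) _).
  have := cvg_inv snd_chart_inv_cvg1; rewrite invg1.
  move=> /near_chartK; apply: filterS => p pE.
  by rewrite /chart_mul /f /= pE.
by rewrite fe; exact: chart_mul_smooth.
Qed.

(** Conjugation is x y x^-1 = (x y) / x, a composite of the product and the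
    quotient as soon as x y is in the domain of the chart. *)
Lemma chart_conj_smooth : smooth_at chart_conj (e, e).
Proof.
pose f (p : 'rV[R]_n * 'rV[R]_n) := (chart_mul p, p.1).
have sf : smooth_at f (e, e).
  by apply: smooth_at_pair; [exact: chart_mul_smooth | exact: smooth_at_fst].
have fe : f (e, e) = (e, e) by rewrite /f /chart_mul /= chart_inv1// mulg1.
apply: near_eq_smooth_at (smooth_at_comp frame_rV2 sf (g := chart_div) _).
  have := cvg_mul fst_chart_inv_cvg1 snd_chart_inv_cvg1; rewrite mulg1.
  move=> /near_chartK; apply: filterS => p pE.
  by rewrite /chart_div /chart_conj /f /chart_mul /= pE.
by rewrite fe; exact: chart_div_smooth.
Qed.

Lemma Ad_linear g : linear (Ad c g).
Proof. by move=> a x y; rewrite /Ad linearP. Qed.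

Lemma Ad1 x : Ad c 1%g x = x.
Proof.
have H : \forall p \near e, c (1 * chart_inv c p * 1^-1)%g = p.
  have := chart_im_nbhs1; apply: filterS => p [u du <-].
  by rewrite invg1 mulg1 mul1g chartK.
have [_ E] :=
  near_eq_diff H (ex_diff : differentiable (fun p : 'rV[R]_n => p) e).
by rewrite /Ad E diff_val.
Qed.

Lemma AdK g : cancel (Ad c g) (Ad c g^-1%g).
Proof. by move=> x; rewrite -Ad_mul// mulVg Ad1. Qed.

Lemma AdVK g : cancel (Ad c g^-1%g) (Ad c g).
Proof. by move=> x; rewrite -Ad_mul// mulgV Ad1. Qed.

(** The differential in [q] of p q p^-1 is a partial derivative of a map that
    is smooth in both variables, which is what makes [Ad] smooth in [p]. *)
Lemma Ad_chartE p v : differentiable chart_conj (p, e) ->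
  Ad c (chart_inv c p) v = 'D_(0, v) chart_conj (p, e).
Proof.
move=> dp; rewrite deriveE//.
exact: (diff_partialr v dp).2.
Qed.

Lemma near_chart_div_diag : \forall p \near e, smooth_at chart_div (p, p).
Proof.
have H := smooth_at_near chart_div_smooth.
have se := smooth_at_id e.
have h := smooth_at_continuous (smooth_at_pair se se).
exact: h _ H.
Qed.

Lemma Ad_chart_smooth p v : smooth_at chart_conj (p, e) ->
  smooth_at (fun q => Ad c (chart_inv c q) v) p.
Proof.
move=> sp.
apply: (@near_eq_smooth_at _ _ _ (fun q => 'D_(0, v) chart_conj (q, e))).
  have := near_smooth_at_pairl sp; apply: filterS => q sq.
  by rewrite Ad_chartE//; exact: smooth_at_differentiable.
apply: (smooth_at_comp (f := fun q => (q, e))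
  (g := fun x => 'D_(0, v) chart_conj x)).
- exact: frame_rV2.
- by apply: smooth_at_pair; [exact: smooth_at_id | exact: smooth_at_cst].
- exact: smooth_at_derive.
Qed.

Lemma Ad_chart_diff v : differentiable (fun q => Ad c (chart_inv c q) v) e.
Proof. exact/smooth_at_differentiable/Ad_chart_smooth/chart_conj_smooth. Qed.

Lemma bracket_linearl Y : linear (bracket c ^~ Y).
Proof. by move=> a u v; rewrite /bracket linearP. Qed.

(** Linearity in [Y] is inherited from [Ad], because differentiation at the
    identity commutes with linear combinations. *)
Lemma bracket_linearr X : linear (bracket c X).
Proof.
move=> a u v; rewrite /bracket.
have -> : (fun p => Ad c (chart_inv c p) (a *: u + v)) =
    a *: (fun p => Ad c (chart_inv c p) u) + (fun p => Ad c (chart_inv c p) v).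
  by apply/funext => p; rewrite Ad_linear.
have du := Ad_chart_diff u; have dv := Ad_chart_diff v.
have dau : differentiable (a *: (fun p => Ad c (chart_inv c p) u)) e.
  exact: differentiableZ.
have /(congr1 (@^~ X)) E := diffD dau dv.
have /(congr1 (@^~ X)) E' := diffZ a du.
by rewrite [LHS]E; congr (_ + _).
Qed.

(** Differentiate Ad(g p g^-1) (Ad(g) Y) = Ad(g) (Ad(p) Y) in [p] at the
    identity. *)
Lemma Ad_bracket g X Y :
  Ad c g (bracket c X Y) = bracket c (Ad c g X) (Ad c g Y).
Proof.
pose F p := c (g * chart_inv c p * g^-1)%g.
pose A Y p := Ad c (chart_inv c p) Y.
have Fe : F e = e by rewrite /F chart_inv1// mulg1 mulgV.
have dF : differentiable F e := conj_chart_diff c1 g.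
have dA Z : differentiable (A Z) e := Ad_chart_diff Z.
have dL Z : differentiable (Ad c g) Z.
  exact/smooth_at_differentiable/smooth_at_linear_rV/Ad_linear.
have H : \forall p \near e, (A (Ad c g Y) \o F) p = (Ad c g \o A Y) p.
  have := near_chartK (conj_chart_cvg1 c1 g); apply: filterS => p pE.
  by rewrite /A /F /= pE -[LHS](Ad_mul c1) -[RHS](Ad_mul c1) mulgVK.
have dr : differentiable (Ad c g \o A Y) e by exact: differentiable_comp.
have [dl E] := near_eq_diff H dr.
have dFA : differentiable (A (Ad c g Y)) (F e).
  by rewrite Fe; exact: dA.
transitivity ('d (Ad c g \o A Y) e X).
  rewrite (diff_compE X (dA Y) (dL _)).
  by rewrite (diff_linear_rV _ _ (Ad_linear g)).
rewrite -E (diff_compE X dF dFA) Fe.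
by [].
Qed.

(** The Jacobi identity in the form in which it follows from [Ad_bracket]:
    differentiate Ad(p) [X, Y] = [Ad(p) X, Ad(p) Y] in [p] along [Z]. *)
Lemma leibniz X Y Z : bracket c Z (bracket c X Y) =
  bracket c (bracket c Z X) Y + bracket c X (bracket c Z Y).
Proof.
pose a p := Ad c (chart_inv c p) X; pose b p := Ad c (chart_inv c p) Y.
have da : differentiable a e := Ad_chart_diff X.
have db : differentiable b e := Ad_chart_diff Y.
have dbr v z : differentiable (bracket c ^~ v) z.
  by apply: differentiable_linear_rV; exact: bracket_linearl.
have [_ E] := diff_apply Z (A := fun p => bracket c (a p)) (b := b)
  (fun p => bracket_linearr (a p))
  (fun w => differentiable_comp da (dbr w _)) db.
have ae : a e = X by rewrite /a chart_inv1// Ad1.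
have be : b e = Y by rewrite /b chart_inv1// Ad1.
have H : (fun p => Ad c (chart_inv c p) (bracket c X Y)) =
    (fun p => bracket c (a p) (b p)).
  by apply/funext => p; rewrite Ad_bracket.
have E1 := diff_compE Z da (dbr (b e) (a e)).
have E2 := diff_linear_rV (a e) ('d a e Z) (bracket_linearl (b e)).
have E3 := etrans E (congr1 (+%R ^~ _) (etrans E1 E2)).
rewrite ae be in E3.
by rewrite {1}/bracket H.
Qed.

End LieGroup.

(** * Invariance of the Killing form *)

(** The Leibniz rule says that ad [X, Y] = ad X ad Y - ad Y ad X.  Hence the
    trace form of ad cannot distinguish [X, Y] from - [Y, X], and it is
    invariant. *)
Section LeibnizAlgebra.
Context {F : fieldType} {n : nat} (b : 'rV[F]_n -> 'rV[F]_n -> 'rV[F]_n).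
Hypothesis linearl : forall Y, linear (b ^~ Y).
Hypothesis linearr : forall X, linear (b X).
Hypothesis leibnizb : forall X Y Z, b Z (b X Y) = b (b Z X) Y + b X (b Z Y).
Local Notation ad X := (lin1_mx (b X)).

Definition trace_form X Y : F := \tr (ad X *m ad Y).

Lemma mul_rV_ad X Y : Y *m ad X = b X Y.
Proof.
pose bX : {linear 'rV[F]_n -> 'rV[F]_n} := HB.pack (b X)
  (GRing.isLinear.Build _ _ _ _ _ (linearr X)).
exact: (mul_rV_lin1 bX).
Qed.

(** Matrices act on row vectors from the right, which reverses the products. *)
Lemma ad_bracket X Y : ad (b X Y) = ad Y *m ad X - ad X *m ad Y.
Proof.
apply/row_matrixP => i; rewrite !rowE mulmxBr !mulmxA !mul_rV_ad.
by rewrite (leibnizb Y) addrK.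
Qed.

Lemma trace_form_linearr X : linear (trace_form X : _ -> F^o).
Proof.
move=> a Y Z; rewrite /trace_form.
have -> : ad (a *: Y + Z) = a *: ad Y + ad Z.
  apply/row_matrixP => i.
  by rewrite !rowE mulmxDr -scalemxAr !mul_rV_ad linearl.
by rewrite mulmxDr -scalemxAr mxtraceD mxtraceZ.
Qed.

Lemma trace_formC X Y : trace_form X Y = trace_form Y X.
Proof. exact: mxtrace_mulC. Qed.

Lemma trace_form_invariant X Y Z :
  trace_form (b Z X) Y = - trace_form X (b Z Y).
Proof.
have trB (A B : 'M[F]_n) : \tr (A - B) = \tr A - \tr B by exact: raddfB.
rewrite /trace_form !ad_bracket mulmxBl mulmxBr !trB opprB !mulmxA.
by congr (_ - _); rewrite -(mulmxA (ad Z)) mxtrace_mulC.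
Qed.

Lemma trace_form_bracketC X Y Z :
  trace_form X (b Y Z) = - trace_form X (b Z Y).
Proof.
have trN (A : 'M[F]_n) : \tr (- A) = - \tr A by exact: raddfN.
by rewrite /trace_form !ad_bracket -trN -(mulmxN (ad X)) opprB.
Qed.

(** <x, [X', Y']> = - <[X', x], Y'> = - <[X, x], Y'> = <x, [X, Y']>
    = - <x, [Y', X]> = <[Y', x], X> = <[Y, x], X>: only the images of [X'] and
    [Y'] at [x] matter. *)
Lemma trace_form_lift x X Y X' Y' : b X' x = b X x -> b Y' x = b Y x ->
  trace_form x (b X' Y') = trace_form X (b Y x).
Proof.
move=> X'x Y'x; apply: oppr_inj.
rewrite -trace_form_invariant X'x trace_form_invariant.
by rewrite trace_form_bracketC opprK -Y'x -trace_form_invariant trace_formC.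
Qed.

End LeibnizAlgebra.

Section KillingForm.
Context {R : realType} {n : nat} {U : lieGroupType R n}.
Context (c : chart R n U) (c1 : is_chart_at1 c).

Lemma killing_linearr X : linear (killing c X : _ -> R^o).
Proof.
exact: trace_form_linearr (bracket_linearl c) (bracket_linearr c1) X.
Qed.

Lemma killingC X Y : killing c X Y = killing c Y X.
Proof. exact: mxtrace_mulC. Qed.

(** The symplectic form pairs the fundamental vector field of [X] with a tangent
    vector as the differential of y |-> <X, y> does: these functions are the
    components of the moment map. *)
Lemma kks_bracket x X Y :
  kks c x (bracket c X x) (bracket c Y x) = killing c X (bracket c Y x).
Proof.
apply: (trace_form_lift (bracket_linearr c1) (leibniz c1)).
  exact: (xgetI 0 (P := [set Z | bracket c Z x = bracket c X x])).
exact: (xgetI 0 (P := [set Z | bracket c Z x = bracket c Y x])).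
Qed.

Lemma bracket0l Y : bracket c 0 Y = 0.
Proof.
have := bracket_linearl c Y (-1) 0 0.
by rewrite !scaleN1r oppr0 addr0 addNr.
Qed.

End KillingForm.

(** * Smooth paths in the group *)

Section Paths.
Context {R : realType} {n : nat} {U : lieGroupType R n}.
Context (c : chart R n U) (c1 : is_chart_at1 c).
Local Notation e := (c 1%g).

(** [xi] is the derivative of [g], translated to the identity from the right,
    as it is seen by the adjoint representation. *)
Definition velocity_path (g : R^o -> U) (xi : R^o -> 'rV[R]_n) : Prop :=
  forall t : R^o, 0 <= t <= 1 ->
  [/\ forall y, smooth_at (fun s => Ad c (g s) y) t,
      smooth_at xi t &
      forall y, is_derive t (1 : R^o) (fun s => Ad c (g s) y)
                  (bracket c (xi t) (Ad c (g t) y))].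

Definition reachable : set U := [set u | exists g xi,
  [/\ velocity_path g xi, g 0 = 1%g & g 1 = u]].

(** Paths are multiplied pointwise: this keeps them smooth, and the velocity of
    g h is xi + Ad(g) eta. *)
Lemma reachable_mul u v : reachable u -> reachable v -> reachable (u * v)%g.
Proof.
move=> [g [xi [gP g0 g1]]] [h [eta [hP h0 h1]]].
exists (fun t => g t * h t)%g, (fun t => xi t + Ad c (g t) (eta t)).
split; [|by rewrite g0 h0 mulg1|by rewrite g1 h1].
move=> t t01; have [sg sxi dg] := gP t t01; have [sh seta dh] := hP t t01.
have E y : (fun s => Ad c (g s * h s)%g y) =
    (fun s => Ad c (g s) (Ad c (h s) y)).
  by apply/funext => s; rewrite Ad_mul.
have lin s : linear (Ad c (g s)) := Ad_linear c (g s).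
have s1 y : smooth_at (fun s => Ad c (g s) (Ad c (h s) y)) t.
  exact: smooth_at_apply lin sg (sh y).
split=> [y||y].
- by rewrite E.
- by apply: smooth_atD => //; exact: smooth_at_apply lin sg seta.
have dgt w := smooth_at_differentiable (sg w).
have dht w := smooth_at_differentiable (sh w).
have [d1 d2] := diff_apply (1 : R^o) lin dgt (dht y).
rewrite E; apply: (diff_is_derive d1); apply: (etrans d2).
have e1 := is_derive_diff (dht y) (dh y).
have e2 := is_derive_diff (dgt (Ad c (h t) y)) (dg _).
apply: (etrans (congr2 +%R e2 (congr1 (Ad c (g t)) e1))).
rewrite (Ad_bracket c1 (g t) (eta t)) (Ad_mul c1 (g t) (h t) y).
have := bracket_linearl c (Ad c (g t) (Ad c (h t) y)) 1 (xi t)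
  (Ad c (g t) (eta t)).
by rewrite !scale1r => ->.
Qed.

(** A point [u] near the identity is joined to it by the segment from c(1) to
    c(u) in the chart.  The velocity is the derivative at s = t of
    g(s) g(t)^-1. *)
Lemma nbhs1_reachable : nbhs (1%g : U) reachable.
Proof.
(* The segment has to stay where [Ad] is smooth along the chart and where the
   quotient is smooth near the diagonal, so that the velocity is smooth. *)
pose good p := [/\ chart_im c p, smooth_at (chart_conj c) (p, e) &
                  smooth_at (chart_div c) (p, p)].
have : nbhs e good.
  near=> p; split; near: p.
  - exact: chart_im_nbhs1.
  - exact: (near_smooth_at_pairl (chart_conj_smooth c1)).
  - exact: near_chart_div_diag.
move=> /nbhs_ballP[r /= r0 rgood].
have cont : c x @[x --> (1%g : U)] --> e.
  by have [_ _ _ + _] := at1_chart c1; apply; case: c1.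
have near1 : \forall u \near (1%g : U), chart_dom c u /\ ball e r (c u).
  near=> u; split; near: u; first exact: chart_dom_nbhs1.
  by apply: cont; exact: nbhsx_ballx.
apply: filterS near1 => u [du].
rewrite -ball_normE /ball_ /= -normrN opprB => ur.
pose w := c u - e.
pose p (t : R^o) : 'rV[R]_n := e + t *: w.
have sp t : smooth_at p t.
  apply: smooth_atD; first exact: smooth_at_cst.
  by apply: smooth_at_scale; [exact: smooth_at_id | exact: smooth_at_cst].
have dp t : 'd p t (1 : R^o) = w by rewrite -[RHS]scale1r; exact: diff_line.
pose g t := chart_inv c (p t).
pose xi t := 'D_(w, 0) (chart_div c) (p t, p t).
exists g, xi; split; last 2 first.
- by rewrite /g /p scale0r addr0 chart_inv1.
- by rewrite /g /p scale1r addrC subrK (chartK c1).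
move=> t t01.
have [imt st sdt] : good (p t) by apply: rgood; exact: segment_ball.
have sA y : smooth_at (fun s => Ad c (g s) y) t.
  apply: (smooth_at_comp (f := p)
    (g := fun q => Ad c (chart_inv c q) y)) => //.
    exact: has_frame_rV.
  exact: Ad_chart_smooth.
split=> //.
  apply: (smooth_at_comp (f := fun s => (p s, p s))
    (g := fun z => 'D_(w, 0) (chart_div c) z)).
  - exact: has_frame_prod (has_frame_rV n) (has_frame_rV n).
  - exact: smooth_at_pair.
  - exact: smooth_at_derive.
move=> y; apply: diff_is_derive; first exact: smooth_at_differentiable.
pose Y := Ad c (g t) y.
pose d s := c (g s * (g t)^-1)%g.
have dd : differentiable d t /\ 'd d t 1 = xi t.
  have ddiv := smooth_at_differentiable sdt.
  have [d1 d2] := diff_partiall w ddiv.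
  have dpt := smooth_at_differentiable (sp t).
  split; first exact: (differentiable_comp dpt d1).
  apply: (etrans (diff_compE (1 : R^o) dpt d1)).
  apply: (etrans
    (congr1 ('d (fun q => chart_div c (q, p t)) (p t)) (dp t))).
  by apply: (etrans d2); apply: esym; exact: deriveE.
have dte : d t = e by rewrite /d mulgV.
(* Ad(g s) y = Ad(g(s) g(t)^-1) (Ad(g t) y), and g(s) g(t)^-1 is close to the
   identity, where the derivative of [Ad] is the bracket. *)
have near_t : \forall s \near t, Ad c (g s) y = Ad c (chart_inv c (d s)) Y.
  have : (g s * (g t)^-1)%g @[s --> t] --> (g t * (g t)^-1)%g.
    apply: cvg_mul; last exact: cvg_cst.
    apply: (cvg_comp p (chart_inv c) (smooth_at_continuous (sp t))).
    exact: chart_inv_cvg.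
  rewrite mulgV => /(near_chartK c1); apply: filterS => s ->.
  by rewrite -(Ad_mul c1) mulgVK.
have [dd1 dd2] := dd.
have dAe : differentiable (fun q => Ad c (chart_inv c q) Y) (d t).
  by rewrite dte; exact: Ad_chart_diff.
have [_ E] := near_eq_diff near_t (differentiable_comp dd1 dAe).
apply: (etrans (congr1 (@^~ (1 : R^o)) E)).
apply: (etrans (diff_compE (1 : R^o) dd1 dAe)).
by rewrite dd2 dte.
Unshelve. all: by end_near. Qed.

End Paths.

(** * The Hamiltonian isotopy *)

Section Main.
Context {R : realType} {n : nat} {U : lieGroupType R n}.
Context (c : chart R n U) (c1 : is_chart_at1 c).

(** The reachable set is stable under products and contains a neighbourhood [N]
    of the identity.  It is open, since v N is a neighbourhood of v; its
    complement is open, since w^-1 v is in N for w close to v. *)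
Lemma reachable_connected u : connected [set: U] -> reachable c u.
Proof.
move=> connU; suff -> : reachable c = [set: U] by [].
apply: connU.
- by exists 1%g; exact: nbhs_singleton (nbhs1_reachable c1).
- exists (reachable c); last by rewrite setTI.
  rewrite openE => v Sv; rewrite /interior.
  have h : (v^-1 * w)%g @[w --> (v : U)] --> (1%g : U).
    by rewrite -(mulVg v); apply: cvg_mul; [exact: cvg_cst | exact: cvg_id].
  near=> w; have -> : w = (v * (v^-1 * w))%g by rewrite mulVKg.
  apply: (reachable_mul c1 Sv); near: w.
  exact: h _ (nbhs1_reachable c1).
- exists (reachable c); last by rewrite setTI.
  rewrite -openC openE => v Sv; rewrite /interior.
  have h : (w^-1 * v)%g @[w --> (v : U)] --> (1%g : U).
    rewrite -(mulVg v); apply: cvg_mul; last exact: cvg_cst.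
    by apply: cvg_inv; exact: cvg_id.
  near=> w; apply: contra_not Sv => Sw.
  have -> : v = (w * (w^-1 * v))%g by rewrite mulVKg.
  apply: (reachable_mul c1 Sw); near: w.
  exact: h _ (nbhs1_reachable c1).
Unshelve. all: by end_near. Qed.

Lemma flag_Ad x g y : flag c x y -> flag c x (Ad c g y).
Proof. by move=> [u _ <-]; exists (g * u)%g => //; rewrite Ad_mul. Qed.

Lemma diffeo_Ad (x y : 'rV[R]_n) (g : U) :
  diffeo (flag c x `*` flag c y) (fun z => (z.1, Ad c g z.2)).
Proof.
have sm h (z : 'rV[R]_n * 'rV[R]_n) : smooth_at (fun z => (z.1, Ad c h z.2)) z.
  apply: smooth_at_pair; first exact: smooth_at_fst.
  apply: (smooth_at_apply (A := fun=> Ad c h)) (smooth_at_snd z).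
    by move=> _; exact: Ad_linear.
  by move=> v; exact: smooth_at_cst.
split.
- by move=> z [z1 z2]; split=> //=; exact: flag_Ad.
- by apply: smooth_at_on => z _; exact: sm.
exists (fun z => (z.1, Ad c g^-1%g z.2)); split.
- by move=> z [z1 z2]; split=> //=; exact: flag_Ad.
- by apply: smooth_at_on => z _; exact: sm.
- by move=> [z1 z2] _ /=; rewrite (AdK c1).
- by move=> [z1 z2] _ /=; rewrite (AdVK c1).
Qed.

(** The Hamiltonian is linear in y, so its differential in the direction
    ([X, x], [Y, y]) is <xi, [Y, y]>, the value given by [kks_bracket]. *)
Lemma hamiltonian_vector_Ad (M : set ('rV[R]_n * 'rV[R]_n)) xi z :
  hamiltonian_vector M (tangent_prod c) (kks_prod c)
    (fun y => killing c xi y.2) z (0, bracket c xi z.2).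
Proof.
have sk (y : 'rV[R]_n * 'rV[R]_n) :
    smooth_at (fun y => killing c xi y.2 : R^o) y.
  apply: (smooth_at_comp (f := snd) (g := killing c xi : _ -> R^o)).
  - exact: has_frame_rV.
  - exact: smooth_at_snd.
  - by apply: smooth_at_linear_rV; exact: killing_linearr.
split; first by exists 0, xi; rewrite bracket0l.
exists (fun y => killing c xi y.2 : R^o).
  by have [D [oD Dz] Ds] := sk z; exists D; split.
move=> _ [X [Y ->]].
have lk := killing_linearr c1 xi.
apply: esym.
apply: (etrans
  (diff_compE (f := snd) (g := killing c xi : _ -> R^o) _ _ _)).
- by apply: smooth_at_differentiable; exact: smooth_at_snd.
- exact: differentiable_linear_rV.
have d2 := diff_sndE z (bracket c X z.1, bracket c Y z.2).
apply: (etrans (congr1 _ d2)).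
apply: (etrans (diff_linear_rV _ _ lk)).
rewrite /kks_prod /=.
have k1 := kks_bracket c1 z.1 0 X.
have k0 : killing c 0 (bracket c X z.1) = 0.
  rewrite killingC; have := killing_linearr c1 (bracket c X z.1) (-1) 0 0.
  by rewrite !scaleN1r oppr0 addr0 addNr.
rewrite k0 bracket0l in k1.
apply: esym; apply: (etrans (congr2 +%R k1 (kks_bracket c1 z.2 xi Y))).
by rewrite add0r.
Qed.

Lemma velocity_path_isotopy (x y : 'rV[R]_n) (g : R^o -> U)
    (xi : R^o -> 'rV[R]_n) (L : set ('rV[R]_n * 'rV[R]_n)) :
  velocity_path c g xi -> g 0 = 1%g ->
  hamiltonian_isotopic (flag c x `*` flag c y) (tangent_prod c) (kks_prod c)
    L [set (z.1, Ad c (g 1) z.2) | z in L].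
Proof.
move=> gP g0.
exists (fun p => (p.2.1, Ad c (g p.1) p.2.2)),
  (fun p => killing c (xi p.1) p.2.2).
have s22 (p : R^o * ('rV[R]_n * 'rV[R]_n)) : smooth_at (fun q => q.2.2) p.
  apply: (smooth_at_comp (f := snd) (g := snd)).
  - exact: has_frame_prod (has_frame_rV n) (has_frame_rV n).
  - exact: smooth_at_snd.
  - exact: smooth_at_snd.
have s21 (p : R^o * ('rV[R]_n * 'rV[R]_n)) : smooth_at (fun q => q.2.1) p.
  apply: (smooth_at_comp (f := snd) (g := fst)).
  - exact: has_frame_prod (has_frame_rV n) (has_frame_rV n).
  - exact: smooth_at_snd.
  - exact: smooth_at_fst.
split.
- split.
    apply: smooth_at_on => p [t01 _]; have [sg _ _] := gP _ t01.
    apply: smooth_at_pair => //.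
    apply: (smooth_at_apply (A := fun q => Ad c (g q.1))) (s22 p).
      by move=> q; exact: Ad_linear.
    move=> v; apply: (smooth_at_comp (f := fst)
      (g := fun s => Ad c (g s) v)) => //.
    + exact: has_frame_R.
    + exact: smooth_at_fst.
  apply: smooth_at_on => p [t01 _]; have [_ sxi _] := gP _ t01.
  apply: (smooth_at_apply (A := fun q => killing c (xi q.1) : _ -> R^o))
    (s22 p).
    by move=> q; exact: killing_linearr.
  move=> v; apply: (smooth_at_comp (f := fun q => xi q.1)
    (g := killing c ^~ v : _ -> R^o)).
  + exact: has_frame_rV.
  + apply: (smooth_at_comp (f := fst) (g := xi)) => //.
    * exact: has_frame_R.
    * exact: smooth_at_fst.
  + apply: smooth_at_linear_rV => a X Y; rewrite ![killing c _ v]killingC.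
    exact: killing_linearr.
- by move=> t t01; exact: (diffeo_Ad x y (g t)).
- by move=> [z1 z2] _ /=; rewrite g0 (Ad1 c1).
- move=> t z /andP[t0 t1] Mz.
  have t01 : 0 <= t <= 1 by rewrite !ltW.
  have [sg _ dg] := gP _ t01.
  exists (0, bracket c (xi t) (Ad c (g t) z.2)); last first.
    exact: hamiltonian_vector_Ad.
  have dA := smooth_at_differentiable (sg z.2).
  have dc := differentiable_cst z.1 t.
  apply: (diff_is_derive (differentiable_pair dc dA)).
  apply: (etrans (congr1 (@^~ (1 : R^o)) (diff_pair dc dA))).
  have d0 := congr1 (@^~ (1 : R^o)) (diff_cst z.1 (t : R^o)).
  exact: (congr2 pair d0 (is_derive_diff dA (dg z.2))).
- by [].
Qed.

(** Seen as graphs: (y, - Ad(m) y) is moved to (y, - Ad(g) Ad(m) y). *)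
Lemma lagrangian_orbit_move x g m :
  [set (z.1, Ad c g z.2) | z in lagrangian_orbit c x m] =
  lagrangian_orbit c x (g * m)%g.
Proof.
rewrite !(lagrangian_orbit_graph c1); apply/seteqP; split=> z.
  move=> [_ [y fy <-] <-]; exists y => //=.
  by rewrite (Ad_mul c1) (AdN c g).
move=> [y fy <-]; exists (y, - Ad c m y); first by exists y.
by rewrite /= (Ad_mul c1) (AdN c g).
Qed.

End Main.

(* In the chart [c] at the identity, [iH] is the element iH of t and
   [isigmaH] is i sigma(H), with sigma = - w_0. *)
Theorem theorem5p7 (R : realType) (n : nat) (U : lieGroupType R n)
    (compactU : compact [set: U]) (connectedU : connected [set: U])
    (c : chart R n U) (c_at1 : is_chart_at1 c) (semisimpleU : semisimple c)
    (T : set U) (maxT : is_maximal_torus T)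
    (P : set ('rV[R]_n -> R)) (posP : is_positive_system c T P)
    (w0 : U) (w0_longest : is_longest c T P w0)
    (iH : 'rV[R]_n) (iH_dom : closure (positive_chamber c T P) iH)
    (m m' : U) :
  let isigmaH := - Ad c w0 iH in
  hamiltonian_isotopic (flag c iH `*` flag c isigmaH)
    (tangent_prod c) (kks_prod c)
    (lagrangian_orbit c iH m) (lagrangian_orbit c iH m').
Proof.
move=> isigmaH.
have [g [xi [gP g0 g1]]] := reachable_connected c_at1 (m' * m^-1)%g connectedU.
rewrite -(mulgVK m m') -(lagrangian_orbit_move c_at1) -g1.
exact: velocity_path_isotopy gP g0.
Qed.
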